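(* For any $b\ge2$, $i\in I$ and $n\ge2$, $$b^{B(n)}<K(n)\le K_i(n)<\beta\, b^{B(n)+1},$$ where $\beta=1$ if $b$ is even and $\beta=\tfrac12$ if $b$ is odd.
   Context: Fix a base $b\ge2$. For $v\in\mathbb{N}$, $s(v)$ is the sum of the base-$b$ digits of $v$, $f(v)=v+s(v)$, and $F(u)=|\{v\in\mathbb{N}: f(v)=u\}|$. $K(n)$ is the smallest $u\in\mathbb{N}$ with $F(u)=n$, and for $n\ge2$, $B(n)=\lfloor\log_b K(n)\rfloor$. The index set $I$ is the set of residue classes modulo $b-1$ if $b$ is even, and the set of even residue classes $\{0,2,\dots,b-3\}$ modulo $b-1$ if $b$ is odd. For $i\in I$, $K_i(n)$ is the smallest $u\in\mathbb{N}$ with $F(u)=n$ and $u\equiv i\pmod{b-1}$. *)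

(* Defs.v *)
From mathcomp Require Import all_boot all_order all_algebra.
From mathcomp Require Import boolp.

Set Implicit Arguments.
Unset Strict Implicit.
Unset Printing Implicit Defensive.

Import Order.TTheory GRing.Theory Num.Theory.

(* For b >= 2 we have v < b ^ v, so the digits of index j >= v all vanish. *)
Definition digit_sum (b v : nat) : nat := \sum_(j < v) (v %/ b ^ j) %% b.

Definition f (b v : nat) : nat := v + digit_sum b v.

Lemma leq_f (b v : nat) : v <= f b v.
Proof. exact: leq_addr. Qed.

(* By [leq_f], every v with f b v = u satisfies v <= u. *)
Definition F (b u : nat) : nat := #|[set v : 'I_u.+1 | f b v == u]|.

(* The least element of P, with value 0 when P is empty. *)
Definition least (P : pred nat) : nat :=
  if pselect (exists u, P u) is left exP then ex_minn exP else 0.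

Definition K (b n : nat) : nat := least [pred u | F b u == n].

Definition B (b n : nat) : nat := trunc_log b (K b n).

(* Residue classes modulo b - 1 are given by their representatives i < b - 1;
   when b is odd, b - 1 is even and parity is well defined on classes. *)
Definition I (b : nat) : pred nat :=
  [pred i | (i < b.-1) && (odd b ==> ~~ odd i)].

Definition Ki (b i n : nat) : nat :=
  least [pred u | (F b u == n) && (u == i %[mod b.-1])].

Definition beta (b : nat) : rat := if odd b then (1 / 2)%R else 1%R.

(* Main.v *)
(* Write M = b^m.  Digit reflection gives f(y) + f(M-1-y) = M-1 + (b-1)m for
   y < M, so if p + q + 2 = (b-1)m and c is a nonzero digit, the solutions of
   f(v) = c(M+1) + p have leading digit c or c-1 and correspond to the solutions
   of f(y) = p and of f(y) = q respectively: F(c(M+1) + p) = F(p) + F(q).  As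
   this value does not depend on c, varying c realizes every class of I without
   leaving [M, beta b^(m+1)).  Finally K(n) has this form with m = B(n): if all
   solutions had the same leading digit, removing it (and reflecting if the
   result is at least M) would give a smaller number with n generators. *)
Require Import Defs.
From mathcomp Require Import all_boot all_order all_algebra.
From mathcomp Require Import boolp zify.

Set Implicit Arguments.
Unset Strict Implicit.
Unset Printing Implicit Defensive.

Import Order.TTheory GRing.Theory Num.Theory.

(** * Least elements and finite sums *)

Lemma leastP (P : pred nat) :
  (exists u, P u) -> P (least P) /\ forall u, P u -> least P <= u.
Proof.
move=> exP; rewrite /least; case: pselect => [exP'|//].
by case: ex_minnP => u Pu min_u.
Qed.

Lemma big_nat_block (k M : nat) (g : nat -> nat) :
  \sum_(v < k * M) g v = \sum_(d < k) \sum_(y < M) g (d * M + y).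
Proof.
elim: k => [|k IHk]; first by rewrite !big_ord0.
rewrite big_ord_recr -IHk /= -!(big_mkord xpredT) mulSn addnC.
rewrite (big_cat_nat (n := k * M)) ?leq_addr //=; congr (_ + _).
rewrite -{1}[k * M]add0n big_addn addKn big_mkord.
by apply: eq_bigr => y _; rewrite addnC.
Qed.

Lemma sum_nat_bool_gt0 (N : nat) (P : pred nat) :
  0 < \sum_(v < N) P v -> exists2 v, v < N & P v.
Proof.
rewrite lt0n sum_nat_eq0 negb_forall => /existsP[v /= Pv].
by exists v => //; move: Pv; case: (P v).
Qed.

Section Base.

Variable b : nat.
Hypothesis b_gt1 : 1 < b.

Let b_gt0 : 0 < b := ltnW b_gt1.

(** * Digit sums: truncation, concatenation, reflection *)

Lemma digit_sum_bound (N v : nat) :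
  v < b ^ N -> digit_sum b v = \sum_(j < N) (v %/ b ^ j) %% b.
Proof.
have trunc n1 n2 : v < b ^ n1 -> n1 <= n2 ->
    \sum_(j < n2) (v %/ b ^ j) %% b = \sum_(j < n1) (v %/ b ^ j) %% b.
  move=> lt_v le_n; rewrite -!(big_mkord xpredT (fun j => (v %/ b ^ j) %% b)).
  rewrite (big_cat_nat (n := n1)) //= [X in _ + X]big1_seq ?addn0 // => j /andP[_].
  rewrite mem_index_iota => /andP[le_j _].
  by rewrite divn_small ?mod0n // (leq_trans lt_v) // leq_pexp2l.
have lt_v : v < b ^ v by exact: ltn_expl.
move=> lt_vN; rewrite /digit_sum.
by rewrite -(trunc _ (maxn v N) lt_v) ?leq_maxl // (trunc N) ?leq_maxr.
Qed.

Lemma digit_sum0 : digit_sum b 0 = 0.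
Proof. by rewrite /digit_sum big_ord0. Qed.

Lemma digit_sum_cons (x y : nat) :
  y < b -> digit_sum b (x * b + y) = digit_sum b x + y.
Proof.
move=> lt_y; have lt_x : x < b ^ x by exact: ltn_expl.
rewrite (@digit_sum_bound x.+1); last by rewrite expnS; nia.
rewrite big_ord_recl expn0 divn1 modnMDl modn_small // addnC.
rewrite (digit_sum_bound lt_x); congr (_ + _); apply: eq_bigr => j _.
by rewrite lift0 expnS divnMA divnMDl // (divn_small lt_y) addn0.
Qed.

Lemma digit_sum_digit (y : nat) : y < b -> digit_sum b y = y.
Proof. by move=> lt_y; have := digit_sum_cons 0 lt_y; rewrite digit_sum0. Qed.

Lemma digit_sum_cat (m x y : nat) :
  y < b ^ m -> digit_sum b (x * b ^ m + y) = digit_sum b x + digit_sum b y.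
Proof.
elim: m y => [|m IHm] y.
  by rewrite expn0 ltnS leqn0 => /eqP->; rewrite digit_sum0 muln1 !addn0.
rewrite expnSr => lt_y; have lt_r := ltn_pmod y b_gt0.
rewrite {1 2}(divn_eq y b) mulnA addnA -mulnDl digit_sum_cons // IHm; last first.
  by rewrite ltn_divLR.
by rewrite digit_sum_cons // addnA.
Qed.

(** Padded to [m] digits, [z] has at each position the complement to [b.-1] of the digit of [y]. *)
Lemma digit_sum_compl (m y z : nat) :
  y + z + 1 = b ^ m -> digit_sum b y + digit_sum b z = b.-1 * m.
Proof.
elim: m y z => [|m IHm] y z.
  rewrite expn0 muln0 => Eyz.
  have [-> ->] : y = 0 /\ z = 0 by lia.
  by rewrite digit_sum0.
have lt_y := ltn_pmod y b_gt0; have lt_z := ltn_pmod z b_gt0.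
rewrite {1 2}(divn_eq y b) {1 2}(divn_eq z b) expnSr.
move: (y %/ b) (z %/ b) (y %% b) (z %% b) lt_y lt_z => y' z' r t lt_r lt_t Eb.
(* No carry occurs: [r + t + 1] is a positive multiple of [b] below [b.*2]. *)
have Ert : r + t + 1 = b.
  have : b %| r + t + 1.
    rewrite -(dvdn_addr _ (dvdn_mull (y' + z') (dvdnn b))).
    by rewrite (_ : _ + _ = b ^ m * b) ?dvdn_mull //; lia.
  case/dvdnP=> -[|[|k]] E; nia.
have := IHm y' z' _; rewrite !digit_sum_cons // => IH.
have : y' + z' + 1 = b ^ m by apply/eqP; rewrite -(eqn_pmul2r b_gt0); apply/eqP; lia.
by move/IH; rewrite mulnS; lia.
Qed.

Lemma expn_linear (m : nat) : b.-1 * m < b ^ m.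
Proof.
elim: m => [|m IHm]; first by rewrite muln0 expn0.
by rewrite expnS mulnS; nia.
Qed.

(** For [c <= b.-1./2] and [p + 2 <= b.-1 * m] this is what gives
    [(c * (b ^ m).+1 + p).*2 < b ^ m.+1]. It fails at [m = 1] once [b >= 4]. *)
Lemma expn_linear2 (m : nat) : 1 < m -> b.-1 * (m.*2.+1) < b ^ m + 4.
Proof.
elim: m => [//|[//|[|m]] IHm] _; first by rewrite expnS expn1; nia.
have := IHm isT; have := expn_linear m.+2.
rewrite [b ^ m.+3]expnS; move: (b ^ _) => M; nia.
Qed.

(** * The map [f] on digit blocks, and its parity *)

Lemma f_cat (m d y : nat) :
  d < b -> y < b ^ m -> f b (d * b ^ m + y) = d * (b ^ m).+1 + f b y.
Proof. by move=> lt_d lt_y; rewrite /f digit_sum_cat // digit_sum_digit //; lia. Qed.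

Lemma f_digit (y : nat) : y < b -> f b y = y.*2.
Proof. by move=> lt_y; rewrite /f digit_sum_digit // addnn. Qed.

Lemma f_compl (m y : nat) : y < b ^ m ->
  f b y + f b (b ^ m - y.+1) + 1 = b ^ m + b.-1 * m.
Proof.
move=> lt_y; have := @digit_sum_compl m y (b ^ m - y.+1); rewrite /f.
by move=> <-; lia.
Qed.

(** For odd [b] every power of [b] is odd, so [v] and its digit sum have the same parity. *)
Lemma odd_f (v : nat) : odd b -> ~~ odd (f b v).
Proof.
move=> b_odd; elim/ltn_ind: v => v IHv.
have [lt_v|le_v] := ltnP v b; first by rewrite f_digit // odd_double.
have lt_r := ltn_pmod v b_gt0.
have := IHv _ (ltn_Pdiv b_gt1 (leq_trans b_gt0 le_v)).
rewrite /f [in X in _ -> X](divn_eq v b) digit_sum_cons // !oddD oddM b_odd andbT.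
by do 3!case: odd.
Qed.

(** * Counting generators *)

Lemma F_sum (N u : nat) : u < N -> F b u = \sum_(v < N) (f b v == u).
Proof.
move=> lt_u; rewrite /F cardsE -sum1_card big_mkcond.
rewrite (eq_bigr (fun v : 'I_u.+1 => nat_of_bool (f b v == u))); last first.
  by move=> v _; rewrite -[_ \in _]/(f b v == u); case: eqP.
rewrite -!(big_mkord xpredT (fun v => nat_of_bool (f b v == u))).
rewrite [RHS](big_cat_nat (n := u.+1)) //= [X in _ + X]big1_seq ?addn0 // => v.
rewrite mem_index_iota => /andP[_ /andP[lt_uv _]].
by case: eqP => // Eu; have := leq_f b v; lia.
Qed.

Lemma F_gt0 (u : nat) : 0 < F b u -> exists2 v, v <= u & f b v = u.
Proof.
rewrite (F_sum (ltnSn u)) => /(sum_nat_bool_gt0 (P := fun v => f b v == u)).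
by case=> v lt_v /eqP Eu; exists v.
Qed.

Lemma F_gt0_odd (u : nat) : odd b -> 0 < F b u -> ~~ odd u.
Proof. by move=> b_odd /F_gt0[v _ <-]; apply: odd_f. Qed.

Lemma F_gt0_small (u : nat) : u < b -> 0 < F b u -> ~~ odd u.
Proof.
by move=> lt_u /F_gt0[v le_v <-]; rewrite f_digit ?odd_double // (leq_ltn_trans le_v).
Qed.

(** The generator is the digit [u./2]. A [v] with [b <= v < b.*2] has [f b v = b + 1 + (v - b).*2],
    which is odd for even [b] and exceeds [u] for odd [b]. *)
Lemma F_small (u : nat) :
  ~~ odd u -> u < b.*2 -> (odd b -> u <= b) -> F b u = 1.
Proof.
move=> u_even lt_u le_u; rewrite /F.
have lt_h : u./2 < u.+1 by lia.
apply/eqP/cards1P; exists (Ordinal lt_h); apply/setP => -[v lt_v].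
rewrite !inE -val_eqE /=.
have [lt_vb|le_b] := ltnP v b; first by rewrite f_digit //; lia.
have Ev : v = 1 * b ^ 1 + (v - b) by rewrite expn1; lia.
rewrite Ev f_cat ?expn1 ?f_digit //; lia.
Qed.

(** * Splitting the count by the digit at position [m] *)

Definition block_count (m w : nat) : nat := \sum_(y < b ^ m) (f b y == w).

Lemma block_count_F (m w : nat) : w < b ^ m -> block_count m w = F b w.
Proof. by move=> lt_w; rewrite (F_sum lt_w). Qed.

Lemma block_count_compl (m w q : nat) :
  w + q + 1 = b ^ m + b.-1 * m -> block_count m w = block_count m q.
Proof.
move=> Ewq; rewrite /block_count (reindex_inj rev_ord_inj) /=.
apply: eq_bigr => y _; congr nat_of_bool.
by have := f_compl (ltn_ord y); rewrite /=; lia.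
Qed.

Lemma block_count_gt0 (m w : nat) :
  0 < block_count m w -> w < b ^ m + b.-1 * m.
Proof.
move=> /(sum_nat_bool_gt0 (P := fun y => f b y == w))[y lt_y /eqP <-].
by have := f_compl lt_y; lia.
Qed.

(** For [d < b], by [f_cat], this counts the generators of [u] below [b ^ m.+1] with digit [d] at
    position [m]; [d = 0] is allowed. *)
Definition digit_count (m u d : nat) : nat :=
  \sum_(y < b ^ m) (d * (b ^ m).+1 + f b y == u).

Lemma digit_countE (m u d w : nat) :
  u = d * (b ^ m).+1 + w -> digit_count m u d = block_count m w.
Proof. by move=> ->; apply: eq_bigr => y _; rewrite eqn_add2l. Qed.

Lemma digit_count_gt0 (m u d : nat) : 0 < digit_count m u d ->
  exists2 w, u = d * (b ^ m).+1 + w & 0 < block_count m w.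
Proof.
move=> H; have := H.
move=> /(sum_nat_bool_gt0 (P := fun y => d * (b ^ m).+1 + f b y == u)).
by case=> y _ /eqP Eu; exists (f b y); rewrite // -(@digit_countE m u d).
Qed.

Lemma F_digit_count (m u : nat) :
  u < b ^ m.+1 -> F b u = \sum_(d < b) digit_count m u d.
Proof.
move=> lt_u; rewrite (F_sum lt_u) expnS.
rewrite (big_nat_block _ _ (fun v => nat_of_bool (f b v == u))).
by apply: eq_bigr => d _; apply: eq_bigr => y _; rewrite f_cat.
Qed.

(** On a block [f b y < b ^ m + b.-1 * m], which is less than [2 * (b ^ m).+1], so a gap of two
    between leading digits cannot be bridged. *)
Lemma digit_count_adjacent (m u d e : nat) : d < e ->
  0 < digit_count m u d -> 0 < digit_count m u e -> e = d.+1.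
Proof.
move=> lt_de /digit_count_gt0[w Ew /block_count_gt0 lt_w].
case/digit_count_gt0=> w' Ew' _; have := expn_linear m.
move: (b ^ m) (b.-1 * m) Ew Ew' lt_w => M L; nia.
Qed.

(** Lowering the leading digit by one turns the remainder [p] into [(b ^ m).+1 + p], whose
    reflection is [q]. *)
Lemma digit_count_pair (m u d p q : nat) :
  u = d.+1 * (b ^ m).+1 + p -> p + q + 2 = b.-1 * m ->
  digit_count m u d.+1 = F b p /\ digit_count m u d = F b q.
Proof.
move=> Eu Epq; have lt_m := expn_linear m; split.
  by rewrite (digit_countE Eu) block_count_F //; lia.
have /digit_countE-> : u = d * (b ^ m).+1 + ((b ^ m).+1 + p) by rewrite Eu; lia.
by rewrite (@block_count_compl _ _ q) ?block_count_F //; lia.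
Qed.

Lemma F_window (m d p q : nat) :
  d.+1 < b -> p + q + 2 = b.-1 * m -> 0 < F b p -> 0 < F b q ->
  d.+1 * (b ^ m).+1 + p < b ^ m.+1 ->
  F b (d.+1 * (b ^ m).+1 + p) = F b p + F b q.
Proof.
move=> lt_d Epq Fp Fq lt_u; rewrite (F_digit_count lt_u).
have [Hp Hq] := digit_count_pair (erefl (d.+1 * (b ^ m).+1 + p)) Epq.
move: Fp Fq; rewrite -Hp -Hq; move: (_ + p) => u Fp Fq.
rewrite (bigD1 (Ordinal lt_d)) //= (bigD1 (Ordinal (ltnW lt_d))) /=; last first.
  by rewrite -val_eqE /= ltn_eqF.
(* Both [d] and [d.+1] contribute, so a third contributing digit would have to be adjacent to each
   of them. *)
rewrite big1 ?addn0 // => e /andP[]; rewrite -!val_eqE /= => ne1 ne0.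
apply/eqP; rewrite -leqn0 leqNgt; apply/negP => Fe.
have [lt_ed|] := ltnP e d.
  by have := digit_count_adjacent (ltn_trans lt_ed (ltnSn d)) Fe Fp; lia.
move=> le_de; have lt_de : d < e by rewrite ltn_neqAle eq_sym ne0.
  by rewrite (digit_count_adjacent lt_de Fq Fe) eqxx in ne1.
Qed.

Lemma least_window (m n u : nat) : 0 < n -> F b u = n ->
  (forall w, F b w = n -> u <= w) -> b ^ m <= u < b ^ m.+1 ->
  exists p q, [/\ p + q + 2 = b.-1 * m, 0 < F b p, 0 < F b q,
    n = F b p + F b q & b ^ m < u].
Proof.
move=> n_gt0 Fu min_u /andP[le_u lt_u].
have lt_m := expn_linear m.
have /existsP[d Hd] : [exists d : 'I_b, 0 < digit_count m u d].
  apply: contraLR n_gt0; rewrite negb_exists => /forallP H0.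
  rewrite -Fu (F_digit_count lt_u) -leqNgt leqn0 sum_nat_eq0.
  by apply/forallP => d /=; have := H0 d; rewrite lt0n negbK.
have [/existsP[e /andP[ne_ed He]]|] :=
  boolP [exists e : 'I_b, (e != d) && (0 < digit_count m u e)]; last first.
  (* With [d] the only contributing digit, [w] or its reflection has [n] generators, against the
     minimality of [u]. *)
  rewrite negb_exists => /forallP H0.
  have Hn : digit_count m u d = n.
    rewrite -Fu (F_digit_count lt_u) (bigD1 d) //= big1 ?addn0 // => e ne_ed.
    by have := H0 e; rewrite ne_ed lt0n negbK => /eqP.
  have [w Eu Hw] := digit_count_gt0 Hd.
  move: Hn; rewrite (digit_countE Eu).
  have [lt_w|le_w] := ltnP w (b ^ m).
    rewrite block_count_F // => /min_u; case: (d : nat) Eu => [|k]; lia.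
  have := block_count_gt0 Hw => lt_w.
  rewrite (@block_count_compl _ _ (b ^ m + b.-1 * m - w.+1)); last by lia.
  rewrite block_count_F; last by lia.
  by move/min_u; lia.
have pair k : k.+1 < b -> 0 < digit_count m u k -> 0 < digit_count m u k.+1 ->
    exists p q, [/\ p + q + 2 = b.-1 * m, 0 < F b p, 0 < F b q,
      n = F b p + F b q & b ^ m < u].
  move=> lt_k Hk Hk1.
  have [w Ew /block_count_gt0 lt_w] := digit_count_gt0 Hk.
  have [p Ep _] := digit_count_gt0 Hk1.
  (* The subtraction is exact: the remainder for digit [k] is [w = (b ^ m).+1 + p], and [lt_w]
     bounds it. *)
  exists p, (b.-1 * m - p.+2).
  have Epq : p + (b.-1 * m - p.+2) + 2 = b.-1 * m by lia.
  have [Hp Hq] := digit_count_pair Ep Epq.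
  rewrite Hp in Hk1; rewrite Hq in Hk; split=> //; last by lia.
  by rewrite -Fu Ep (F_window lt_k Epq) // -Ep.
have [lt|lt|/val_inj E] := ltngtP d e; last by rewrite E eqxx in ne_ed.
  by have Ee := digit_count_adjacent lt Hd He; apply: (pair d); rewrite -?Ee.
by have Ed := digit_count_adjacent lt He Hd; apply: (pair e); rewrite -?Ed.
Qed.

(** * Reaching every residue class below the bound *)

Lemma ex_repr_pos (N x : nat) :
  0 < N -> exists2 c, c < N & c.+1 = x %[mod N].
Proof.
move=> N_gt0; exists ((x + N.-1) %% N); first exact: ltn_pmod.
by rewrite -addn1 modnDml -addnA addn1 prednK // modnDr.
Qed.

(** The bound by [beta b] times [b ^ m.+1], doubled for odd [b] to stay in [nat]. *)
Definition below_beta (m u : nat) : bool :=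
  if odd b then u.*2 < b ^ m.+1 else u < b ^ m.+1.

Lemma window_residue (m c p : nat) :
  c * (b ^ m).+1 + p = c.*2 + p %[mod b.-1].
Proof.
have [k Ek] : exists k, b ^ m = k * b.-1 + 1.
  exists (\sum_(j < m) b ^ j).
  by rewrite mulnC -predn_exp addn1 prednK // expn_gt0 b_gt0.
have -> : c * (b ^ m).+1 + p = c * k * b.-1 + (c.*2 + p) by rewrite Ek; lia.
exact: modnMDl.
Qed.

Lemma window_fill_generic (m p q i : nat) : i \in I b ->
  p + q + 2 = b.-1 * m -> 0 < F b p -> 0 < F b q -> (m = 1 -> odd b && (p == 0)) ->
  exists u, [/\ F b u = F b p + F b q, u = i %[mod b.-1] & below_beta m u].
Proof.
rewrite !inE => /andP[lt_i i_even] Epq Fp Fq m1.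
have m_gt0 : 0 < m by case: (m) Epq => //; rewrite muln0; lia.
have res := window_residue m; rewrite /below_beta.
have [b_odd|b_even] := boolP (odd b).
  have p_even := F_gt0_odd b_odd Fp; rewrite b_odd /= in i_even.
  have N_gt0 : 0 < b.-1./2 by lia.
  (* The congruence [c.+1.*2 + p = i] modulo [b.-1] is halved, all terms being even; the factor
     [b.-1./2.-1] acts as -1. The shift to [c.+1] keeps the leading digit nonzero. *)
  have [c lt_c Ec] := ex_repr_pos (i./2 + p./2 * b.-1./2.-1) N_gt0.
  have lt_u : (c.+1 * (b ^ m).+1 + p).*2 < b ^ m.+1.
    have [m_gt1|] := ltnP 1 m.
      have := expn_linear2 m_gt1; rewrite expnS; move: (b ^ m) => M; nia.
    (* With [p = 0], twice the largest candidate is [b ^ 2 - 1], so the bound is tight. *)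
    move=> le_m1; have Em : m = 1 by lia.
    have /andP[_ /eqP->] := m1 Em.
    rewrite Em expn1 expnS expn1; nia.
  exists (c.+1 * (b ^ m).+1 + p); split=> //.
    by apply: F_window => //; lia.
  rewrite res.
  have Eb : b.-1 = b.-1./2 * 2 by lia.
  have -> : c.+1.*2 + p = (c.+1 + p./2) * 2 by lia.
  have {1}-> : i = i./2 * 2 by lia.
  rewrite {1 2}Eb -!muln_modl; congr (_ * 2).
  rewrite -modnDml Ec modnDml -addnA -{2}[p./2]muln1 -mulnDr addn1 prednK //.
  by rewrite addnC modnMDl.
have [h Eb] : exists h, b = h * 2 by exists b./2; lia.
have N_gt0 : 0 < b.-1 by lia.
(* Since [h * 2 = b] is 1 modulo [b.-1], [h] inverts 2, while [b.-2] acts as -1. *)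
have [c lt_c Ec] := ex_repr_pos ((i + p * b.-2) * h) N_gt0.
have m_gt1 : 1 < m.
  case: (m) m_gt0 m1 => [|[|]] // _ /(_ erefl).
  by rewrite (negPf b_even).
have lt_u : c.+1 * (b ^ m).+1 + p < b ^ m.+1.
  have := expn_linear2 m_gt1; have : 2 <= b.-1 * m by nia.
  rewrite expnS mulnS -mul2n mulnCA; move: (b ^ m) (b.-1 * m) Epq => M L Epq.
  have : c.+1 * M.+1 <= b.-1 * M.+1 by rewrite leq_mul2r lt_c orbT.
  have -> : b.-1 * M.+1 = b * M - M + b.-1 by case: (b) b_gt0 => //= b' _; lia.
  have : M <= b * M by rewrite leq_pmull.
  by lia.
exists (c.+1 * (b ^ m).+1 + p); split=> //.
  by apply: F_window => //; lia.
rewrite res -muln2 -modnDml -modnMml Ec modnMml modnDml -mulnA -Eb.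
have -> : (i + p * b.-2) * b + p = (i + p * b.-2 + p) + (i + p * b.-2) * b.-1.
  by rewrite -[X in _ * X + _](prednK b_gt0) mulnS; lia.
rewrite addnC modnMDl -addnA -{2}[p]muln1 -mulnDr addn1 prednK ?[i + _]addnC.
  by rewrite modnMDl.
by lia.
Qed.

Lemma window_fill (m p q i : nat) : i \in I b ->
  p + q + 2 = b.-1 * m -> 0 < F b p -> 0 < F b q ->
  exists u, [/\ F b u = F b p + F b q, u = i %[mod b.-1] & below_beta m u].
Proof.
move=> Ii Epq Fp Fq.
have [m1|m1] := eqVneq m 1; last first.
  by apply: (window_fill_generic Ii Epq) => // /eqP; rewrite (negPf m1).
(* Here the bound [below_beta] can fail for p > 0, but F b p = F b q = 1, so
   (p, q) may be replaced by (0, p + q). *)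
move: Epq; rewrite m1 muln1 => Epq.
have p_even : ~~ odd p by apply: F_gt0_small => //; lia.
have q_even : ~~ odd q by apply: F_gt0_small => //; lia.
(* Here [b.-1 = p + q + 2] is a sum of even numbers. *)
have b_odd : odd b by lia.
have F0 : F b 0 = 1 by apply: F_small => //; lia.
have Fb : F b (p + q) = 1 by apply: F_small => [||_]; lia.
have -> : F b p = F b 0 by rewrite F0; apply: F_small => [||_]; lia.
have -> : F b q = F b (p + q) by rewrite Fb; apply: F_small => [||_]; lia.
by apply: window_fill_generic; rewrite ?F0 ?Fb ?muln1 ?b_odd.
Qed.

(** Induction on [n]: a [p] with [n] generators in class 0 and a [q] with one generator in class -2
    make [p + q + 2] a multiple of [b.-1], so [window_fill] gives [n.+1] generators in any class of
    [I b]. *)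
Lemma F_surj_residue (n i : nat) : 0 < n -> i \in I b ->
  exists2 u, F b u = n & u = i %[mod b.-1].
Proof.
have base j : j \in I b -> exists2 u, F b u = 1 & u = j %[mod b.-1].
  rewrite !inE => /andP[lt_j j_even].
  have [odd_j|even_j] := boolP (odd j); last first.
    by exists j => //; apply: F_small => // [|_]; lia.
  (* An odd [j] in [I b] forces [b] even, and adding the odd number [b.-1] makes it even. *)
  by exists (j + b.-1); [apply: F_small => [||]; lia | rewrite modnDr].
elim: n i => // -[_ i _ /base //|n IHn i _ Ii].
have N_gt0 : 0 < b.-1 by lia.
have I0 : 0 \in I b by rewrite !inE N_gt0 implybT.
have [p Fp p0] := IHn 0 isT I0.
have Ik : (b.-1 * 2 - 2) %% b.-1 \in I b.
  rewrite !inE ltn_pmod //=; apply/implyP => b_odd.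
  by have := divn_eq (b.-1 * 2 - 2) b.-1; lia.
have [q Fq Eq] := base _ Ik.
have /dvdnP[m Em] : b.-1 %| p + q + 2.
  rewrite /dvdn -addnA -modnDml p0 mod0n add0n -modnDml Eq modn_mod modnDml.
  by rewrite subnK ?modnMr //; lia.
have [|||u [Fu Eu _]] := @window_fill m p q i Ii; rewrite ?Fp ?Fq //.
  by rewrite Em mulnC.
by exists u; rewrite // Fu Fp Fq addn1.
Qed.

End Base.

Theorem theorem4p8 (b i n : nat) (hb : 2 <= b) (hi : i \in I b) (hn : 2 <= n) :
  [/\ b ^ B b n < K b n,
      K b n <= Ki b i n &
      ((Ki b i n)%:R < beta b * b%:R ^+ (B b n + 1)%N :> rat)%R].
Proof.
have n_gt0 : 0 < n by exact: ltnW.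
have [u Fu Eu] := F_surj_residue hb n_gt0 hi.
have [/eqP FK minK] : F b (K b n) == n /\ forall u, F b u == n -> K b n <= u.
  by apply: (leastP (P := [pred u | F b u == n])); exists u; rewrite /= Fu.
have [/andP[/eqP FKi EKi] minKi] :
    (F b (Ki b i n) == n) && (Ki b i n == i %[mod b.-1]) /\
    forall u, (F b u == n) && (u == i %[mod b.-1]) -> Ki b i n <= u.
  apply: (leastP (P := [pred u | (F b u == n) && (u == i %[mod b.-1])])).
  by exists u; rewrite /= Fu Eu !eqxx.
(* Zero has exactly one generator, whereas [n >= 2]; positivity is needed for the bounds on
   [trunc_log]. *)
have K_gt0 : 0 < K b n.
  case: posnP FK => // ->; rewrite F_small //; lia.
have /(least_window hb n_gt0 FK) : b ^ B b n <= K b n < b ^ (B b n).+1.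
  exact: trunc_log_bounds.
case=> [w /eqP/minK //|p [q [Epq Fp Fq En lt_K]]].
(* The pair read off from [K b n] is reused at the same [m = B b n] to reach class [i]. *)
have [w [Fw Ew lt_w]] := window_fill hb hi Epq Fp Fq.
split=> //; first by apply: minK; rewrite FKi.
have le_Ki : Ki b i n <= w by apply: minKi; rewrite Fw -En Ew !eqxx.
move: lt_w; rewrite /below_beta /beta addn1; case: ifP => _ lt_w.
  rewrite mulrC mulrA mulr1 ltr_pdivlMr // -natrM -natrX ltr_nat muln2.
  by apply: leq_ltn_trans lt_w; rewrite leq_double.
by rewrite mul1r -natrX ltr_nat (leq_ltn_trans le_Ki).
Qed.
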